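(* Let $h:R'\to R''$ be a surjection of commutative $\mathbb{Z}[\rho]$-algebras such that every element of $h^{-1}(1+\eta^pR'')$ is a unit in $R'$. If $S''/R''$ is a $C_p$ Galois extension, then there is a $C_p$ Galois extension $S'/R'$ such that $S'\otimes_{R',h}R''\cong S''$ as $C_p$ Galois extensions of $R''$.
   Context: $p$ is a prime, $C_p$ is the cyclic group of order $p$, $\rho$ is a primitive $p$-th root of one, $\mathbb{Z}[\rho]=\mathbb{Z}[X]/(X^{p-1}+\cdots+1)$, and $\eta=\rho-1$ (also denoting its image in any $\mathbb{Z}[\rho]$-algebra). ''Galois'' is in the sense of Galois extensions of commutative rings; isomorphisms of $C_p$ Galois extensions are algebra isomorphisms over the base commuting with the $C_p$-actions. *)

(* Defs.v *)
From HB Require Import structures.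
From mathcomp Require Import all_boot all_order all_algebra all_fingroup.
From mathcomp Require Import generic_quotient qpoly.
From mathcomp Require Import boolp.

Set Implicit Arguments.
Unset Strict Implicit.
Unset Printing Implicit Defensive.

Import GRing.Theory.
Local Open Scope ring_scope.
Local Open Scope quotient_scope.

(* Commutative rings are [comPzRingType]s, so the zero ring is included.      *)
(* MathComp's [comAlgType] excludes the zero ring, so an algebra over a       *)
(* commutative ring A is given here by its structure morphism.                *)

(* 1 + X + ... + X^(p-1) *)
Definition cyclo_sum (p : nat) : {poly int} := \sum_(i < p) 'X^i.

Lemma cyclo_sumE (p : nat) : cyclo_sum p = \poly_(i < p) 1.
Proof.
by rewrite poly_def; apply: eq_bigr => i _; rewrite scale1r.
Qed.

(* [{poly %/ q}] is the quotient by [mk_monic q], which falls back to 'X      *)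
(* unless q is monic and nonconstant; for p > 1 this does not happen.         *)
Lemma mk_monic_cyclo_sum (p : nat) :
  (1 < p)%N -> mk_monic (cyclo_sum p) = cyclo_sum p.
Proof.
move=> p1; have p0 : (0 < p)%N by apply: ltnW.
have sz : size (cyclo_sum p) = p by rewrite cyclo_sumE size_poly_eq ?oner_eq0.
rewrite /mk_monic sz p1 /= monicE /lead_coef sz cyclo_sumE coef_poly.
by rewrite ltn_predL p0 eqxx.
Qed.

Notation Zrho p := {poly %/ cyclo_sum p}.

Definition rho (p : nat) : Zrho p := 'qX.
Definition eta (p : nat) : Zrho p := rho p - 1.

Definition invertible (R : comPzRingType) (x : R) : Prop :=
  exists y : R, x * y = 1.

(* A commutative R-algebra with an action of G by R-algebra automorphisms. *)
Record galg (G : finGroupType) (R : comPzRingType) := Galg {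
  galg_ring :> comPzRingType;
  galg_str : {rmorphism R -> galg_ring};
  galg_act : G -> {rmorphism galg_ring -> galg_ring};
  galg_act1 : forall s, galg_act 1%g s = s;
  galg_actM : forall g g' s, galg_act (g * g')%g s = galg_act g (galg_act g' s);
  galg_act_str : forall g r, galg_act g (galg_str r) = galg_str r
}.

(* S/R is G-Galois (Chase-Harrison-Rosenberg): R embeds in S with image the   *)
(* fixed ring S^G, and there are x_i, y_i in S such that                      *)
(* \sum_i x_i g(y_i) is 1 for g = 1 and 0 for g <> 1.                         *)
Definition is_galois (G : finGroupType) (R : comPzRingType) (S : galg G R) :
    Prop :=
  [/\ injective (galg_str S),
      forall s : S, (forall g : G, galg_act S g s = s) ->
        exists r : R, galg_str S r = s
    & exists (n : nat) (x y : 'I_n -> S), forall g : G,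
        \sum_(i < n) x i * galg_act S g (y i) = (g == 1%g)%:R].

Definition galg_iso (G : finGroupType) (R : comPzRingType) (S T : galg G R) :
    Prop :=
  exists f : {rmorphism S -> T},
    [/\ bijective f,
        forall r : R, f (galg_str S r) = galg_str T r
      & forall (g : G) (s : S), f (galg_act S g s) = galg_act T g (f s)].

(* The tensor product of two commutative R-algebras S and T: formal finite    *)
(* sums of pairs (s, t), standing for s (x) t, modulo the least congruence    *)
(* making (x) biadditive and R-balanced. Classical logic is used to take the  *)
(* quotient.                                                                  *)
Section Tensor.
Variables (R S T : comPzRingType).
Variables (f : {rmorphism R -> S}) (g : {rmorphism R -> T}).

Inductive tens_rel : seq (S * T) -> seq (S * T) -> Prop :=
| tens_refl u : tens_rel u u
| tens_sym u v : tens_rel u v -> tens_rel v u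
| tens_trans u v w : tens_rel u v -> tens_rel v w -> tens_rel u w
| tens_cat u u' v v' :
    tens_rel u u' -> tens_rel v v' -> tens_rel (u ++ v) (u' ++ v')
| tens_catC u v : tens_rel (u ++ v) (v ++ u)
| tens_addl s s' t : tens_rel [:: (s + s', t)] [:: (s, t); (s', t)]
| tens_addr s t t' : tens_rel [:: (s, t + t')] [:: (s, t); (s, t')]
| tens_0l t : tens_rel [:: (0, t)] [::]
| tens_0r s : tens_rel [:: (s, 0)] [::]
| tens_bal r s t : tens_rel [:: (s * f r, t)] [:: (s, g r * t)].

Definition tens_relb (u v : seq (S * T)) : bool := `[< tens_rel u v >].

Fact tens_relb_refl : reflexive tens_relb.
Proof. by move=> u; apply/asboolP/tens_refl. Qed.
Fact tens_relb_sym : symmetric tens_relb.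
Proof. by move=> u v; apply/asboolP/asboolP => /tens_sym. Qed.
Fact tens_relb_trans : transitive tens_relb.
Proof.
by move=> v u w /asboolP uv /asboolP vw; apply/asboolP/(tens_trans uv vw).
Qed.

Canonical tens_equiv :=
  EquivRel tens_relb tens_relb_refl tens_relb_sym tens_relb_trans.

Definition tens := {eq_quot tens_equiv}.
HB.instance Definition _ : EqQuotient _ tens_equiv tens := EqQuotient.on tens.
HB.instance Definition _ := Choice.on tens.

Definition tpi (u : seq (S * T)) : tens := \pi_tens u.
Definition trepr (x : tens) : seq (S * T) := repr x.

Lemma tpiE u v : tens_rel u v <-> tpi u = tpi v.
Proof.
by split=> [uv|/eqmodP/asboolP//]; apply/eqmodP/asboolP.
Qed.

Lemma treprK x : tpi (trepr x) = x.
Proof. exact: reprK. Qed.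

Lemma trepr_pi u : tens_rel (trepr (tpi u)) u.
Proof. by apply/tpiE; rewrite treprK. Qed.

Definition tzero : tens := tpi [::].
Definition tadd (x y : tens) : tens := tpi (trepr x ++ trepr y).
Definition sopp (u : seq (S * T)) := [seq (- q.1, q.2) | q <- u].
Definition topp (x : tens) : tens := tpi (sopp (trepr x)).
(* (s (x) t) (s' (x) t') = s s' (x) t t', extended biadditively *)
Definition smul (u v : seq (S * T)) : seq (S * T) :=
  [seq (q.1 * q'.1, q.2 * q'.2) | q <- u, q' <- v].
Definition tone : tens := tpi [:: (1, 1)].
Definition tmul (x y : tens) : tens := tpi (smul (trepr x) (trepr y)).

Lemma tadd_pi u v : tadd (tpi u) (tpi v) = tpi (u ++ v).
Proof. by apply/tpiE/tens_cat; apply: trepr_pi. Qed.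

Lemma tens_map (h : S * T -> S * T) :
    (forall s s' t, tens_rel [:: h (s + s', t)] [:: h (s, t); h (s', t)]) ->
    (forall s t t', tens_rel [:: h (s, t + t')] [:: h (s, t); h (s, t')]) ->
    (forall t, tens_rel [:: h (0, t)] [::]) ->
    (forall s, tens_rel [:: h (s, 0)] [::]) ->
    (forall r s t, tens_rel [:: h (s * f r, t)] [:: h (s, g r * t)]) ->
  forall u v, tens_rel u v -> tens_rel (map h u) (map h v).
Proof.
move=> hDl hDr h0l h0r hb u v; elim=> {u v} //=.
- by move=> u; apply: tens_refl.
- by move=> u v _; apply: tens_sym.
- by move=> u v w _ uv _; apply: tens_trans.
- by move=> u u' v v' _ uu' _ vv'; rewrite !map_cat; apply: tens_cat.
- by move=> u v; rewrite !map_cat; apply: tens_catC.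
Qed.

Lemma sopp_rel u v : tens_rel u v -> tens_rel (sopp u) (sopp v).
Proof.
apply: tens_map => /= *; rewrite ?opprD ?oppr0 -?mulNr;
  by [apply: tens_addl | apply: tens_addr | apply: tens_0l | apply: tens_0r
     | apply: tens_bal].
Qed.

Lemma sopp_addl u : tens_rel (sopp u ++ u) [::].
Proof.
elim: u => [|[s t] u IHu]; first exact: tens_refl.
apply: (@tens_trans _ ([:: (- s, t); (s, t)] ++ (sopp u ++ u))).
  rewrite -(cat1s (s, t) u) /sopp map_cat -/sopp -!catA /=.
  rewrite -[X in tens_rel X _]cat1s -[X in tens_rel _ X]cat1s.
  apply: tens_cat; first exact: tens_refl.
  rewrite -[X in tens_rel _ X]cat1s -[X in _ ++ X]cat1s !catA.
  by apply: tens_cat; [exact: tens_catC | exact: tens_refl].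
rewrite -[X in tens_rel _ X](cats0 [::]); apply: tens_cat => //.
apply: tens_trans (tens_0l t); rewrite -(addNr s).
by apply: tens_sym; apply: tens_addl.
Qed.

Lemma smul_consl q u v :
  smul (q :: u) v = [seq (q.1 * q'.1, q.2 * q'.2) | q' <- v] ++ smul u v.
Proof. by []. Qed.

Lemma smul_catl u u' v : smul (u ++ u') v = smul u v ++ smul u' v.
Proof. by rewrite /smul allpairs_cat. Qed.

Lemma smul_relr u v v' : tens_rel v v' -> tens_rel (smul u v) (smul u v').
Proof.
move=> vv'; elim: u => [|[a b] u IHu]; first exact: tens_refl.
rewrite !smul_consl; apply: tens_cat => //; move: vv'.
apply: tens_map => /= [s s' t|s t t'|t|s|r s t].
- by rewrite mulrDr; apply: tens_addl.
- by rewrite mulrDr; apply: tens_addr.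
- by rewrite mulr0; apply: tens_0l.
- by rewrite mulr0; apply: tens_0r.
- by rewrite mulrA mulrCA; apply: tens_bal.
Qed.

Lemma smulC u v : tens_rel (smul u v) (smul v u).
Proof.
have smulr0 w : smul w [::] = [::] by elim: w.
have smul1C q w : map (fun q' => (q.1 * q'.1, q.2 * q'.2)) w = smul w [:: q].
  elim: w => //= q' w ->.
  by rewrite smul_consl /= ![q.1 * _]mulrC ![q.2 * _]mulrC.
have smul_catr w a b : tens_rel (smul w a ++ smul w b) (smul w (a ++ b)).
  elim: w => [|q w IHw]; first exact: tens_refl.
  rewrite !smul_consl map_cat -!catA.
  apply: tens_cat; first exact: tens_refl.
  apply: (@tens_trans _ (map (fun q' => (q.1 * q'.1, q.2 * q'.2)) b ++
                        (smul w a ++ smul w b))).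
    rewrite !catA; apply: tens_cat; last exact: tens_refl.
    exact: tens_catC.
  by apply: tens_cat => //; exact: tens_refl.
elim: u => [|q u IHu]; first by rewrite smulr0; exact: tens_refl.
rewrite smul_consl smul1C -[q :: u]cat1s.
apply: tens_trans (smul_catr v [:: q] u).
by apply: tens_cat => //; exact: tens_refl.
Qed.

Lemma smul_rel u u' v v' :
  tens_rel u u' -> tens_rel v v' -> tens_rel (smul u v) (smul u' v').
Proof.
move=> uu' vv'; apply: (tens_trans (smul_relr u vv')).
apply: (tens_trans (smulC _ _)); apply: (tens_trans (smul_relr v' uu')).
exact: smulC.
Qed.

Lemma tmul_pi u v : tmul (tpi u) (tpi v) = tpi (smul u v).
Proof. by apply/tpiE/smul_rel; apply: trepr_pi. Qed.

Lemma smulA u v w : smul u (smul v w) = smul (smul u v) w.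
Proof.
elim: u => [|q u IHu] //.
rewrite !smul_consl smul_catl IHu; congr (_ ++ _).
elim: v {IHu} => [|q' v IHv] //.
rewrite map_cons !smul_consl map_cat IHv; congr (_ ++ _).
by rewrite -map_comp; apply: eq_map => q'' /=; rewrite !mulrA.
Qed.

Fact taddA : associative tadd.
Proof.
by move=> x y z; rewrite -(treprK x) -(treprK y) -(treprK z) !tadd_pi catA.
Qed.
Fact taddC : commutative tadd.
Proof. by move=> x y; apply/tpiE/tens_catC. Qed.
Fact tadd0 : left_id tzero tadd.
Proof. by move=> x; rewrite -(treprK x) tadd_pi. Qed.
Fact taddN : left_inverse tzero topp tadd.
Proof.
by move=> x; rewrite -{2}(treprK x) tadd_pi; apply/tpiE/sopp_addl.
Qed.
Fact tmulA : associative tmul.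
Proof.
by move=> x y z; rewrite -(treprK x) -(treprK y) -(treprK z) !tmul_pi smulA.
Qed.
Fact tmulC : commutative tmul.
Proof. by move=> x y; apply/tpiE/smulC. Qed.
Fact tmul1 : left_id tone tmul.
Proof.
move=> x; rewrite -(treprK x) tmul_pi smul_consl cats0.
by rewrite (eq_map (g := id)) ?map_id // => -[s t] /=; rewrite !mul1r.
Qed.
Fact tmulDl : left_distributive tmul tadd.
Proof.
move=> x y z; rewrite -(treprK x) -(treprK y) -(treprK z).
by rewrite !(tadd_pi, tmul_pi) smul_catl.
Qed.

HB.instance Definition _ :=
  GRing.isZmodule.Build tens taddA taddC tadd0 taddN.
HB.instance Definition _ :=
  GRing.Zmodule_isComPzRing.Build tens tmulA tmulC tmul1 tmulDl.

Definition tens_inr (t : T) : tens := tpi [:: (1, t)].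

Fact tens_inr_zmod : zmod_morphism tens_inr.
Proof.
move=> t t'; apply/eqP; rewrite eq_sym subr_eq; apply/eqP.
rewrite [RHS](_ : _ = tadd (tens_inr (t - t')) (tens_inr t')) // tadd_pi.
by apply/tpiE; rewrite -{1}(subrK t' t); apply: tens_addr.
Qed.
Fact tens_inr_monoid : monoid_morphism tens_inr.
Proof.
split=> // t t'.
rewrite [RHS](_ : _ = tmul (tens_inr t) (tens_inr t')) // tmul_pi.
by rewrite /smul /= mulr1.
Qed.

HB.instance Definition _ := GRing.isZmodMorphism.Build T tens tens_inr
  tens_inr_zmod.
HB.instance Definition _ := GRing.isMonoidMorphism.Build T tens tens_inr
  tens_inr_monoid.

End Tensor.

(* a (x) id, for an R-algebra endomorphism a of S *)
Section TensorMap.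
Variables (R S T : comPzRingType).
Variables (f : {rmorphism R -> S}) (g : {rmorphism R -> T}).
Variables (a : {rmorphism S -> S}) (af : forall r, a (f r) = f r).

Local Notation tens := (tens f g).
Local Notation tpi := (tpi f g).

Definition smap (u : seq (S * T)) := [seq (a q.1, q.2) | q <- u].
(* The proof that a is R-linear is an argument so that it is available to the *)
(* morphism instances below. *)
Definition tens_mapl of (forall r, a (f r) = f r) := fun x : tens =>
  tpi (smap (trepr x)).

Lemma smap_rel u v : tens_rel f g u v -> tens_rel f g (smap u) (smap v).
Proof.
apply: tens_map => /= *; rewrite ?rmorphD ?rmorph0 ?rmorphM ?af;
  by [apply: tens_addl | apply: tens_addr | apply: tens_0l | apply: tens_0r
     | apply: tens_bal].
Qed.

Lemma tens_mapl_pi u : tens_mapl af (tpi u) = tpi (smap u).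
Proof. by apply/tpiE/smap_rel/trepr_pi. Qed.

Fact tens_mapl_zmod : zmod_morphism (tens_mapl af).
Proof.
have mD x y : tens_mapl af (x + y) = tens_mapl af x + tens_mapl af y.
  rewrite -(treprK x) -(treprK y).
  rewrite [X in tens_mapl _ X](tadd_pi f g) !tens_mapl_pi.
  by rewrite [RHS](tadd_pi f g) /smap map_cat.
by move=> x y; apply/eqP; rewrite eq_sym subr_eq -mD subrK.
Qed.
Fact tens_mapl_monoid : monoid_morphism (tens_mapl af).
Proof.
split=> [|x y].
  by rewrite [X in tens_mapl _ X](_ : 1 = tpi [:: (1, 1)]) // tens_mapl_pi
       /smap /= rmorph1.
rewrite -(treprK x) -(treprK y) [X in tens_mapl _ X](tmul_pi f g).
rewrite !tens_mapl_pi [RHS](tmul_pi f g); congr (tpi _).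
elim: (trepr x) => [|q u IHu] //.
rewrite [smap (q :: u)]/= !smul_consl /smap map_cat -/smap -IHu.
congr (_ ++ _); rewrite /smap -!map_comp.
by apply: eq_map => q' /=; rewrite rmorphM.
Qed.

HB.instance Definition _ := GRing.isZmodMorphism.Build tens tens
  (tens_mapl af) tens_mapl_zmod.
HB.instance Definition _ := GRing.isMonoidMorphism.Build tens tens
  (tens_mapl af) tens_mapl_monoid.

End TensorMap.

(* S (x)_(R, h) R', as an R'-algebra with G acting through S *)
Section BaseChange.
Variables (G : finGroupType) (R R' : comPzRingType) (h : {rmorphism R -> R'}).
Variable S : galg G R.

Definition bc_act (a : G) :
    {rmorphism tens (galg_str S) h -> tens (galg_str S) h} :=
  tens_mapl (g := h) (@galg_act_str G R S a).

Fact bc_act1 x : bc_act 1%g x = x.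
Proof.
rewrite -(treprK x) /bc_act /= tens_mapl_pi; congr (tpi _ _ _).
rewrite /smap (eq_map (g := id)) ?map_id // => -[s t] /=.
by rewrite galg_act1.
Qed.
Fact bc_actM a b x : bc_act (a * b)%g x = bc_act a (bc_act b x).
Proof.
rewrite -(treprK x) /bc_act /= !tens_mapl_pi; congr (tpi _ _ _).
rewrite /smap -map_comp; apply: eq_map => -[s t] /=.
by rewrite galg_actM.
Qed.
Fact bc_act_str a r :
  bc_act a (tens_inr (galg_str S) h r) = tens_inr (galg_str S) h r.
Proof. by rewrite /bc_act /= tens_mapl_pi /smap /= rmorph1. Qed.

Definition base_change : galg G R' :=
  @Galg G R' (tens (galg_str S) h) (tens_inr (galg_str S) h) bc_act
    bc_act1 bc_actM bc_act_str.

End BaseChange.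

(* Main.v *)
(* Put c_n = 1 + rho + ... + rho^(n-1), let g in C_p = Z/p act on polynomials *)
(* by g X = rho^g X + c_g, and let F(X) be the product of the X - c_i for i < *)
(* p; it is invariant. Twisting the action on S'' by powers of rho keeps it   *)
(* semilinear, so its H^1 vanishes because S'' has an element of trace 1, and *)
(* this gives theta in S'' with g(theta) = rho^g theta + c_g. Then F(theta)   *)
(* is invariant, hence the image of some a'' in R''. For any lift a' of a'',  *)
(* 1 + eta^p a' is a unit by hypothesis; since 1 + eta X divides 1 + eta^p    *)
(* F(X), the image of 1 + eta X in S' = R'[X]/(F(X) - a') is a unit. As g(X)  *)
(* - X = c_g (1 + eta X) with c_g a unit for g <> 1, S' is Galois over R'.    *)
(* Finally X |-> theta induces an equivariant map from S' (x) R'' to S'', and *)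
(* any such map is bijective by the trace formula t = \sum_i x_i Tr(t y_i).   *)

From HB Require Import structures.
Require Import Defs.
From mathcomp Require Import all_boot all_order all_algebra all_fingroup qpoly.
From mathcomp Require Import boolp ring.

Set Implicit Arguments.
Unset Strict Implicit.
Unset Printing Implicit Defensive.

Import GRing.Theory.
Local Open Scope ring_scope.

(** Write c_n as [qnum] and F as [qnum_prod]. Then eta^p F(X) = (1 + eta X)^p - 1, so F(X) = a is a
    Kummer equation in 1 + eta X where eta is invertible, and the Artin-Schreier equation X^p - X =
    a where p = eta = 0. A single parameter a thus determines the extension, and a lifts along a
    surjection. [exists_trace1] and [exists_affine] put S'' in this form, [exists_affine_extension]
    builds the extension for the lifted parameter, and [equivariant_bijective] compares its base
    change with S''. *)

(** * The elements c_n and the invariant polynomial F *)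

Definition qnum (A : pzRingType) (r : A) (n : nat) : A := \sum_(i < n) r ^+ i.

Definition qnum_prod (A : pzRingType) (r : A) (p : nat) (x : A) : A :=
  \prod_(i < p) (x - qnum r i).

Lemma qnumD (A : pzRingType) (r : A) m n :
  qnum r (m + n) = qnum r m + r ^+ m * qnum r n.
Proof.
rewrite /qnum big_split_ord mulr_sumr /=; congr (_ + _).
by apply: eq_bigr => i _; rewrite exprD.
Qed.

Lemma qnum0 (A : pzRingType) (r : A) : qnum r 0 = 0.
Proof. exact: big_ord0. Qed.

Lemma qnumSl (A : pzRingType) (r : A) n : qnum r n.+1 = 1 + r * qnum r n.
Proof. by rewrite -addn1 addnC qnumD expr1 /qnum big_ord1 expr0. Qed.

Lemma rmorph_qnum (A B : pzRingType) (f : {rmorphism A -> B}) r n :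
  f (qnum r n) = qnum (f r) n.
Proof. by rewrite rmorph_sum; apply: eq_bigr => i _; rewrite rmorphXn. Qed.

Lemma rmorph_qnum_prod (A B : comPzRingType) (f : {rmorphism A -> B}) r p x :
  f (qnum_prod r p x) = qnum_prod (f r) p (f x).
Proof.
by rewrite rmorph_prod; apply: eq_bigr => i _; rewrite rmorphB rmorph_qnum.
Qed.

Section RootOfUnity.
Variables (A : comPzRingType) (r : A) (p : nat).
Hypothesis qnum_p : qnum r p = 0.

Lemma qnum0_expr : r ^+ p = 1.
Proof. by apply/eqP; rewrite -subr_eq0 subrX1 -/(qnum r p) qnum_p mulr0. Qed.

Lemma qnum_mod n : qnum r (n %% p) = qnum r n.
Proof.
have q_mul k : qnum r (k * p) = 0.
  by elim: k => [|k IHk]; rewrite ?qnum0 // mulSn qnumD IHk qnum_p mulr0 addr0.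
rewrite [in RHS](divn_eq n p) qnumD q_mul mulnC exprM qnum0_expr expr1n.
by rewrite mul1r add0r.
Qed.

(** Choose j with kj = 1 mod p. The product of c_k and the same sum of j powers formed with r^k is
    c_(kj) = c_1 = 1. *)
Lemma qnum_invertible k : coprime k p -> (0 < k)%N -> invertible (qnum r k).
Proof.
move=> co_kp k_gt0.
case: (egcdnP p k_gt0) => j m jk _; rewrite (eqP co_kp) in jk.
exists (\sum_(i < j) (r ^+ k) ^+ i).
have -> : qnum r k * (\sum_(i < j) (r ^+ k) ^+ i) = qnum r (k * j).
  rewrite mulnC; elim: j {jk} => [|j IHj].
    by rewrite big_ord0 qnum0 mulr0.
  rewrite big_ord_recr /= mulrDr IHj mulSn addnC qnumD -exprM mulnC.
  by rewrite [qnum r k * _]mulrC.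
rewrite mulnC jk -qnum_mod modnMDl qnum_mod /qnum big_ord1.
exact: expr0.
Qed.

(** The map x |-> rx + 1 permutes the roots cyclically: rx + 1 - c_(i+1) = r(x - c_i), with c_p = 0
    = c_0. The p factors r multiply to 1. *)
Lemma qnum_prod_shift x :
  (0 < p)%N -> qnum_prod r p (r * x + 1) = qnum_prod r p x.
Proof.
case: p qnum_p qnum0_expr => // n q0 rX _; rewrite /qnum_prod.
rewrite big_ord_recl [RHS]big_ord_recr /=.
have -> : r * x + 1 - qnum r 0 = r * (x - qnum r n).
  by rewrite qnum0 subr0 mulrBr; congr (_ + _); apply/eqP;
     rewrite -addr_eq0 -qnumSl q0.
under eq_bigr => i _ do
  rewrite /bump leq0n add1n qnumSl opprD addrA addrK -mulrBr.
rewrite big_split /= prodr_const card_ord mulrACA -exprS rX mul1r.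
exact: mulrC.
Qed.

Lemma qnum_prod_stable g x :
  (0 < p)%N -> qnum_prod r p (r ^+ g * x + qnum r g) = qnum_prod r p x.
Proof.
move=> p_gt0; elim: g => [|g IHg]; first by rewrite mul1r qnum0 addr0.
by rewrite exprS qnumSl [1 + _]addrC addrA -mulrA -mulrDr qnum_prod_shift.
Qed.

(** For p = 2 the product is r = -1. For odd p the exponent p(p-1)/2 of r is a multiple of p. *)
Lemma prod_opp_expr : prime p -> \prod_(i < p) - r ^+ i = -1.
Proof.
move=> p_pr; case: (even_prime p_pr) => [p2|p_odd].
  move: qnum_p; rewrite p2 /qnum !big_ord_recr !big_ord0 /= !(expr0, expr1).
  by rewrite add0r mul1r mulN1r opprK => /eqP; rewrite addrC addr_eq0 => /eqP.
rewrite prodrN card_ord -signr_odd p_odd expr1 prodrXr.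
rewrite -(big_mkord xpredT id) bin2_sum bin2odd //.
by rewrite exprM qnum0_expr expr1n mulr1.
Qed.

(* With [u = 1 + (r - 1) x] one has                                           *)
(* [(r - 1)^p qnum_prod r p x = \prod_i (u - r^i)], which is congruent to     *)
(* [\prod_i (- r^i) = -1] modulo [u]; hence [u] divides the left-hand side.   *)
Lemma invertible_qnum_prod x : prime p ->
  invertible (1 + (r - 1) ^+ p * qnum_prod r p x) ->
  invertible (1 + (r - 1) * x).
Proof.
move=> p_pr; set u := 1 + (r - 1) * x.
have -> : (r - 1) ^+ p * qnum_prod r p x = \prod_(i < p) (u - r ^+ i).
  rewrite -{1}(card_ord p) -prodr_const -big_split /=.
  by apply: eq_bigr => i _; rewrite mulrBr -subrX1 opprB addrA [_ + 1]addrC.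
have [w prodE] : exists w, \prod_(i < p) (u - r ^+ i) =
    u * w + \prod_(i < p) - r ^+ i.
  apply: (big_rec2 (fun y z => exists w, y = u * w + z)) => [|i y z _ [w ->]].
    by exists 0; rewrite mulr0 add0r.
  exists ((u - r ^+ i) * w + z).
  by ring.
rewrite prodE prod_opp_expr // addrC subrK => -[y uwy].
by exists (w * y); rewrite mulrA.
Qed.

End RootOfUnity.

(** * Traces, dual bases and equivariant maps *)

Section Trace.
Variables (G : finGroupType) (R : comPzRingType) (S : galg G R).

Definition trace (s : S) : S := \sum_(g : G) galg_act S g s.

Definition dual_bases n (x y : 'I_n -> S) :=
  forall g : G, \sum_(i < n) x i * galg_act S g (y i) = (g == 1%g)%:R.

Lemma traceD : {morph trace : s t / s + t}.
Proof.
by move=> s t; rewrite -big_split; apply: eq_bigr => g _; rewrite rmorphD.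
Qed.

Lemma trace_strl r s : trace (galg_str S r * s) = galg_str S r * trace s.
Proof.
by rewrite mulr_sumr; apply: eq_bigr => g _; rewrite rmorphM galg_act_str.
Qed.

Lemma act_trace g s : galg_act S g (trace s) = trace s.
Proof.
rewrite rmorph_sum [RHS](reindex_inj (mulgI g)) /=.
by apply: eq_bigr => k _; rewrite galg_actM.
Qed.

Lemma trace_expand n (x y : 'I_n -> S) s :
  dual_bases x y -> \sum_(i < n) x i * trace (s * y i) = s.
Proof.
move=> xy; under eq_bigr => i _ do rewrite mulr_sumr.
rewrite exchange_big /= (bigD1 1%g) //= [X in _ + X]big1 => [|g g_neq1].
  under eq_bigr => i _ do rewrite galg_act1 mulrCA -[y i]galg_act1.
  by rewrite -mulr_sumr xy eqxx mulr1 addr0.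
under eq_bigr => i _ do rewrite rmorphM mulrCA.
by rewrite -mulr_sumr xy (negPf g_neq1) mulr0.
Qed.

(* Nakayama by the determinant trick: [S = Tr(S) S] is finitely generated, so *)
(* an element of [1 + Tr(S)] annihilates [S].                                 *)
Lemma exists_trace1 : is_galois S -> exists c : S, trace c = 1.
Proof.
case=> _ S_fix [n [x [y xy]]].
have trace_str s : exists r, galg_str S r = trace s.
  by apply: S_fix => g; apply: act_trace.
pose B := \matrix_(i < n, j < n) ((i == j)%:R - trace (x i * y j)).
(* [eqmod z z'] is congruence modulo Tr(S) to an element of the image of R. As Tr(S) is an ideal of
   that image, the relation passes through sums and products, hence through the Leibniz formula for
   [\det B]. *)
pose eqmod z z' := (exists r, galg_str S r = z') /\ exists c, z = z' + trace c.
have eqmodM a a' b b' : eqmod a a' -> eqmod b b' -> eqmod (a * b) (a' * b').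
  move=> [[ra <-] [ca ->]] [[rb <-] [cb ->]]; split.
    by exists (ra * rb); rewrite rmorphM.
  have [t tE] := trace_str cb.
  exists (galg_str S ra * cb + galg_str S rb * ca + galg_str S t * ca).
  rewrite !traceD !trace_strl tE; ring.
have eqmodD a a' b b' : eqmod a a' -> eqmod b b' -> eqmod (a + b) (a' + b').
  move=> [[ra <-] [ca ->]] [[rb <-] [cb ->]]; split.
    by exists (ra + rb); rewrite rmorphD.
  by exists (ca + cb); rewrite traceD addrACA.
have trace0 : trace 0 = 0.
  by rewrite /trace big1 // => g _; rewrite rmorph0.
have eqmod_str r : eqmod (galg_str S r) (galg_str S r).
  by split; [exists r | exists 0; rewrite trace0 addr0].
have [_ [c detB]] : eqmod (\det B) (\det (1%:M : 'M_n)).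
  rewrite /determinant.
  apply: (big_rec2 eqmod) => [|s a a' _ aa'].
    by rewrite -(rmorph0 (galg_str S)).
  apply: (eqmodD) => //; apply: (eqmodM).
    by rewrite -(rmorph_sign (galg_str S)).
  apply: (big_rec2 eqmod) => [|i b b' _ bb'].
    by rewrite -(rmorph1 (galg_str S)).
  apply: (eqmodM) => //; rewrite !mxE; split.
    by exists (i == s i)%:R; rewrite rmorph_nat.
  exists (- (x i * y (s i))).
  congr (_ + _); rewrite /trace -sumrN; apply: eq_bigr => g _.
  by rewrite rmorphN.
have Bx : B *m (\col_i x i) = 0.
  apply/matrixP => i j; rewrite !mxE.
  under eq_bigr => k _ do rewrite !mxE mulrBl.
  rewrite sumrB -[X in _ - X]/(\sum_k _).
  under [X in _ - X]eq_bigr => k _ do rewrite mulrC.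
  rewrite trace_expand // (bigD1 i) //= eqxx mul1r big1 ?addr0 ?subrr //.
  by move=> k /negPf ki; rewrite eq_sym ki mul0r.
have det_x i : \det B * x i = 0.
  have := congr1 (mulmx (\adj B)) Bx.
  rewrite mulmxA mul_adj_mx mul_scalar_mx mulmx0.
  by move=> /matrixP/(_ i ord0); rewrite !mxE.
(* [\det B] kills every x_i, and 1 = \sum_i x_i y_i. *)
have det0 : \det B = 0.
  rewrite -[LHS]mulr1 -[X in _ * X]/(true%:R) -(eqxx (1%g : G)) -xy mulr_sumr.
  by rewrite big1 // => i _; rewrite mulrA det_x mul0r.
exists (- c); rewrite /trace.
under eq_bigr => g _ do rewrite rmorphN.
rewrite sumrN -/(trace c); apply/eqP; rewrite eq_sym -addr_eq0.
by rewrite -(det1 S n) -detB det0.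
Qed.

End Trace.
Arguments dual_bases {G R} S {n} x y.

(** If f(t) = 0, the coordinates Tr(t y_i) lie in R and map to 0 in S, where R embeds, so t = 0. For
    surjectivity, the images of x and y are dual bases of S, and the coordinates of s in them lie in
    R. The hypotheses on T are those that pass directly to a base change. *)
Lemma equivariant_bijective (G : finGroupType) (R : comPzRingType)
    (T S : galg G R) (f : {rmorphism T -> S}) n (x y : 'I_n -> T) :
  dual_bases T x y ->
  (forall t : T, exists r, galg_str T r = trace t) ->
  is_galois S ->
  (forall r, f (galg_str T r) = galg_str S r) ->
  (forall g t, f (galg_act T g t) = galg_act S g (f t)) ->
  bijective f.
Proof.
move=> xy T_trace [S_inj S_fix _] f_str f_act.
have f_trace t : f (trace t) = trace (f t).
  by rewrite rmorph_sum; apply: eq_bigr => g _; apply: f_act.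
have f_inj : injective f.
  suff f_ker t : f t = 0 -> t = 0.
    by move=> s t fst; apply/subr0_eq/f_ker; rewrite rmorphB fst subrr.
  move=> ft; rewrite -[t](trace_expand _ xy) big1 // => i _.
  have [r rE] := T_trace (t * y i).
  suff r0 : r = 0 by rewrite -rE r0 rmorph0 mulr0.
  apply: S_inj; rewrite -f_str rE f_trace rmorphM ft mul0r rmorph0.
  by rewrite /trace big1 // => g _; rewrite rmorph0.
have f_xy : dual_bases S (f \o x) (f \o y).
  move=> g /=; rewrite -(rmorph_nat f) -xy rmorph_sum.
  by apply: eq_bigr => i _; rewrite rmorphM f_act.
have f_surj s : exists t, f t = s.
  have /choice[r rE] i : exists r, galg_str S r = trace (s * f (y i)).
    by apply: S_fix => g; apply: act_trace.
  exists (\sum_(i < n) x i * galg_str T (r i)).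
  rewrite -[RHS](trace_expand _ f_xy) rmorph_sum.
  by apply: eq_bigr => i _; rewrite rmorphM f_str rE.
have [g fK] := choice f_surj.
by exists g => // t; apply: f_inj; rewrite fK.
Qed.

(** * An affine generator of a given extension *)

Lemma Zp_mulE p (g h : 'Z_p) : (1 < p)%N -> (g * h)%g = ((g + h) %% p)%N :> nat.
Proof. by move=> p_gt1; congr (_ %% _)%N; apply: Zp_cast. Qed.

(* Multiplying the action of g by r^-g gives another semilinear action, for   *)
(* which g |-> qnum r (-g) is a cocycle; since the trace is surjective it is  *)
(* a coboundary.                                                              *)
Lemma exists_affine p (R : comPzRingType) (S : galg 'Z_p R) (r : R) :
  (1 < p)%N -> qnum r p = 0 -> is_galois S ->
  exists theta : S, forall g : 'Z_p,
    galg_act S g theta =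
      galg_str S r ^+ g * theta + qnum (galg_str S r) g.
Proof.
move=> p_gt1 r_p S_gal; have [c c1] := exists_trace1 S_gal.
set q := galg_str S r.
have q_p : qnum q p = 0 by rewrite -rmorph_qnum r_p rmorph0.
(* The usual averaging of the cocycle against c. After reindexing, coefficients agree because c_g +
   q^g c_((gh)^-1) = c_(h^-1), indices being read modulo p. *)
exists (\sum_(h : 'Z_p) qnum q (h^-1)%g * galg_act S h c) => g.
rewrite rmorph_sum [X in _ ^+ _ * X](reindex_inj (mulgI g)) mulr_sumr.
rewrite -[X in _ + X]mulr1 -c1 -(act_trace g c) rmorph_sum mulr_sumr -big_split.
apply: eq_bigr => h _; rewrite rmorphM -rmorph_qnum galg_act_str.
rewrite rmorph_qnum -galg_actM mulrA -[RHS]mulrDl; congr (_ * _).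
rewrite addrC -qnumD -(qnum_mod q_p (g + _)) -Zp_mulE //; congr (qnum q _).
by rewrite Zp_mulgC invMg mulgKV.
Qed.

(** * Tensor products and base change *)

Section TensorTheory.
Variables (R S T : comPzRingType).
Variables (f : {rmorphism R -> S}) (g : {rmorphism R -> T}).

Definition tens_inl (s : S) : tens f g := tpi f g [:: (s, 1)].

Fact tens_inl_zmod : zmod_morphism tens_inl.
Proof.
move=> s s'; apply/eqP; rewrite eq_sym subr_eq; apply/eqP.
rewrite [RHS](_ : _ = tadd (tens_inl (s - s')) (tens_inl s')) // tadd_pi.
by apply/tpiE; rewrite -{1}(subrK s' s); apply: tens_addl.
Qed.

Fact tens_inl_monoid : monoid_morphism tens_inl.
Proof.
split=> // s s'.
rewrite [RHS](_ : _ = tmul (tens_inl s) (tens_inl s')) // tmul_pi.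
by rewrite /smul /= mulr1.
Qed.

HB.instance Definition _ :=
  GRing.isZmodMorphism.Build S (tens f g) tens_inl tens_inl_zmod.
HB.instance Definition _ :=
  GRing.isMonoidMorphism.Build S (tens f g) tens_inl tens_inl_monoid.

Lemma tens_inlr r : tens_inl (f r) = tens_inr f g (g r).
Proof. by apply/tpiE; have := tens_bal f g r 1 1; rewrite mul1r mulr1. Qed.

Lemma tpi_sum u :
  tpi f g u = \sum_(q <- u) tens_inl q.1 * tens_inr f g q.2.
Proof.
elim: u => [|[s t] u IHu]; first by rewrite big_nil.
rewrite big_cons -IHu /= -[LHS]/(tpi f g ([:: (s, t)] ++ u)) -tadd_pi.
congr (tadd _ _); rewrite [RHS](_ : _ = tmul (tens_inl s) (tens_inr f g t)) //.
by rewrite tmul_pi /smul /= mulr1 mul1r.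
Qed.

End TensorTheory.

Lemma exists_rmorphism (A B : pzRingType) (f : A -> B) :
  zmod_morphism f -> monoid_morphism f ->
  exists phi : {rmorphism A -> B}, phi =1 f.
Proof.
move=> fB fM.
by exists (HB.pack_for {rmorphism A -> B} f
  (GRing.isZmodMorphism.Build A B f fB)
  (GRing.isMonoidMorphism.Build A B f fM)).
Qed.

(** The evaluation [ev] of formal sums respects every generator of [tens_rel], so it may be computed
    on representatives. *)
Lemma exists_tens_lift (R S T B : comPzRingType)
    (f : {rmorphism R -> S}) (g : {rmorphism R -> T})
    (a : {rmorphism S -> B}) (b : {rmorphism T -> B}) :
  (forall r, a (f r) = b (g r)) ->
  exists phi : {rmorphism tens f g -> B},
    (forall s, phi (tens_inl f g s) = a s) /\
    (forall t, phi (tens_inr f g t) = b t).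
Proof.
move=> ab; pose ev u := \sum_(q <- u) a q.1 * b q.2.
have ev_rel u v : tens_rel f g u v -> ev u = ev v.
  rewrite /ev; elim=> {u v} //.
  - by move=> u v w _ -> _ ->.
  - by move=> u u' v v' _ uu' _ vv'; rewrite !big_cat uu' vv'.
  - by move=> u v; rewrite !big_cat; apply: addrC.
  - by move=> s s' t; rewrite !big_cons !big_nil /= rmorphD mulrDl !addr0.
  - by move=> s t t'; rewrite !big_cons !big_nil /= rmorphD mulrDr !addr0.
  - by move=> t; rewrite big_cons !big_nil /= rmorph0 mul0r addr0.
  - by move=> s; rewrite big_cons !big_nil /= rmorph0 mulr0 addr0.
  - by move=> r s t; rewrite !big_cons !big_nil /= !rmorphM ab mulrA.
have evK u : ev (trepr (tpi f g u)) = ev u by apply/ev_rel/trepr_pi.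
have evM u v : ev (smul u v) = ev u * ev v.
  rewrite /ev big_allpairs_dep mulr_suml; apply: eq_bigr => q _.
  by rewrite mulr_sumr; apply: eq_bigr => q' _; rewrite /= !rmorphM mulrACA.
have evD u v : ev (u ++ v) = ev u + ev v by rewrite /ev big_cat.
have ev_additive (x y : tens f g) :
    ev (trepr (x + y)) = ev (trepr x) + ev (trepr y).
  by rewrite -evD -(evK (_ ++ _)).
have [||phi phiE] := @exists_rmorphism (tens f g) B (fun x => ev (trepr x)).
- move=> x y /=; apply/eqP.
  by rewrite eq_sym subr_eq -ev_additive subrK.
- split=> [|x y]; first by rewrite /= evK /ev big_seq1 /= !rmorph1 mulr1.
  by rewrite /= -evM -(evK (smul _ _)).
exists phi; split=> [s|t]; rewrite phiE evK /ev big_seq1 /= rmorph1.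
  exact: mulr1.
exact: mul1r.
Qed.

Section BaseChangeTheory.
Variables (G : finGroupType) (R R' : comPzRingType) (h : {rmorphism R -> R'}).
Variable S : galg G R.
Local Notation inl := (tens_inl (galg_str S) h).
Local Notation T := (base_change h S).

Lemma base_change_act_inl (g : G) s :
  galg_act T g (inl s) = inl (galg_act S g s).
Proof. by rewrite /= tens_mapl_pi. Qed.

Lemma dual_bases_base_change n (x y : 'I_n -> S) :
  dual_bases S x y -> dual_bases T (inl \o x) (inl \o y).
Proof.
move=> xy g; rewrite -(rmorph_nat inl) -xy rmorph_sum.
by apply: eq_bigr => i _; rewrite base_change_act_inl rmorphM.
Qed.

(** By additivity it suffices that Tr(s (x) u) = Tr(s) (x) u = 1 (x) h(c)u, where c maps to
    Tr(s). *)
Lemma trace_base_change :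
  (forall s : S, exists r, galg_str S r = trace s) ->
  forall t : T, exists r, galg_str T r = trace t.
Proof.
move=> S_trace t; rewrite -(treprK t) tpi_sum.
elim: (trepr t) => [|[s u] v [r rE]].
  by exists 0; rewrite big_nil rmorph0 /trace big1 // => g _; rewrite rmorph0.
have [c cE] := S_trace s; exists (h c * u + r).
rewrite big_cons rmorphD rE traceD; congr (_ + _).
rewrite mulrC [X in trace X]mulrC rmorphM /=.
rewrite [RHS](trace_strl (S := T)); congr (_ * _).
rewrite -[LHS]tens_inlr cE rmorph_sum; apply: eq_bigr => g _.
by rewrite base_change_act_inl.
Qed.

End BaseChangeTheory.

(** * Morphisms out of polynomial quotients *)

(** The polynomial quotients are formed over a [comNzRingType]; an equality of structures allows a
    ring with 1 != 0 to be replaced by case analysis. *)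
Lemma exists_nzring (R : comPzRingType) :
  1 != 0 :> R -> exists R0 : comNzRingType, (R0 : comPzRingType) = R.
Proof.
move=> R_nt.
exists (HB.pack_for comNzRingType (GRing.ComPzRing.sort R)
  (GRing.PzSemiRing_isNonZero.Build (GRing.ComPzRing.sort R) R_nt)).
by case: R R_nt => T [] *.
Qed.

Lemma zero_ring_eq (R : pzRingType) (x y : R) : 1 = 0 :> R -> x = y.
Proof. by move=> R0; rewrite -[x]mul1r -[y]mul1r R0 !mul0r. Qed.

Lemma exists_poly_lift (A : comNzRingType) (B : comPzRingType)
    (f : {rmorphism A -> B}) (b : B) :
  exists phi : {rmorphism {poly A} -> B},
    (forall c, phi c%:P = f c) /\ phi 'X = b.
Proof.
have [B0|/exists_nzring[B1 eqB]] := eqVneq (1 : B) 0.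
  have [||phi _] := @exists_rmorphism {poly A} B (fun=> 0).
  - by move=> x y; apply: zero_ring_eq.
  - by split=> [|x y]; apply: zero_ring_eq.
  by exists phi; split=> *; apply: zero_ring_eq.
case: B / eqB in f b *.
have fb : commr_rmorph f b by move=> c; apply: mulrC.
exists (horner_morph fb : {rmorphism {poly A} -> B1}).
by split=> [c|]; rewrite /= ?horner_morphC ?horner_morphX.
Qed.

Lemma exists_qpoly_lift (A : comNzRingType) (B : comPzRingType) (q : {poly A})
    (phi : {rmorphism {poly A} -> B}) :
  q \is monic -> (1 < size q)%N -> phi q = 0 ->
  exists psi : {rmorphism {poly %/ q} -> B},
    forall P, psi (in_qpoly q P) = phi P.
Proof.
move=> q_monic q_size phi_q.
have qE : mk_monic q = q by rewrite /mk_monic q_size q_monic.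
have phi_in P : phi (in_qpoly q P : {poly A}) = phi P.
  rewrite /= qE [in RHS](Pdiv.RingMonic.rdivp_eq q_monic P).
  by rewrite rmorphD rmorphM phi_q mulr0 add0r.
have [||psi psiE] :=
    @exists_rmorphism {poly %/ q} B (fun x => phi (x : {poly A})).
- by move=> x y /=; rewrite rmorphB.
- split=> [|x y]; first by rewrite -(rmorph1 phi).
  by rewrite -[x * y]/(in_qpoly q ((x : {poly A}) * y)) phi_in rmorphM.
by exists psi => P; rewrite psiE phi_in.
Qed.

Lemma in_qpolyK (A : comNzRingType) (q : {poly A}) (x : {poly %/ q}) :
  in_qpoly q (x : {poly A}) = x.
Proof. by apply/val_inj/in_qpoly_small/size_mk_monic. Qed.

Lemma qpoly_ext (A : comNzRingType) (B : comPzRingType) (q : {poly A})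
    (phi psi : {rmorphism {poly %/ q} -> B}) :
  (forall c, phi (in_qpoly q c%:P) = psi (in_qpoly q c%:P)) ->
  phi (qpolyX q) = psi (qpolyX q) -> phi =1 psi.
Proof.
move=> eqC eqX x; rewrite -(in_qpolyK x).
elim/poly_ind: (x : {poly A}) => [|P c IHP]; first by rewrite !rmorph0.
by rewrite !(rmorphD, rmorphM) /= IHP eqC -/(qpolyX q) eqX.
Qed.

(** * Separated conjugates and the extension defined by F(X) = a *)

(** The root bound for domains survives because the differences z_j - z_i, being units, cancel when
    a linear factor is split off. *)
Lemma separated_roots_eq0 (B : comNzRingType) (I : eqType) (z : I -> B)
    (s : seq I) (P : {poly B}) :
  uniq s -> (forall i j, i != j -> invertible (z i - z j)) ->
  (forall i, root P (z i)) -> (size P <= size s)%N -> P = 0.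
Proof.
move=> s_uniq z_sep P_root.
have {P_root} : forall i, i \in s -> root P (z i) by [].
elim: s s_uniq P => [|i s IHs] /=.
  by move=> _ P _; rewrite size_poly_leq0 => /eqP.
move=> /andP[i_s s_uniq] P P_root P_size.
have /factor_theorem[Q PE] := P_root i (mem_head i s).
suff Q0 : Q = 0 by rewrite PE Q0 mul0r.
apply: IHs => // [j js|].
  have [w zw] : invertible (z j - z i).
    by apply: z_sep; apply: contraNneq i_s => <-.
  have := P_root j; rewrite inE js orbT => /(_ isT).
  rewrite PE !rootE hornerM hornerXsubC => /eqP Qz.
  by rewrite -[X in X == _]mulr1 -zw mulrA Qz mul0r.
have [->|Q_neq0] := eqVneq Q 0; first by rewrite size_poly0.
by move: P_size; rewrite PE size_Mmonic ?monicXsubC // size_XsubC addn2.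
Qed.

(** With w_k inverse to z - k(z), the product over k != 1 of (g(z) - k(z)) w_k is 1 at g = 1 and has
    a zero factor k = g otherwise. Expanding it gives a sum of terms x_i g(y_i). *)
Lemma exists_dual_bases (G : finGroupType) (R : comPzRingType) (S : galg G R)
    (z : S) :
  (forall g : G, g != 1%g -> invertible (z - galg_act S g z)) ->
  exists n (x y : 'I_n -> S), dual_bases S x y.
Proof.
move=> z_sep; pose ev (u : seq (S * S)) g :=
  \sum_(q <- u) q.1 * galg_act S g q.2.
suff [u uE] : exists u, forall g, ev u g = (g == 1%g)%:R.
  exists (size u), (fun i => (nth (0, 0) u i).1), (fun i => (nth (0, 0) u i).2).
  by move=> g; rewrite -uE /ev (big_nth (0, 0)) big_mkord.
have evM u v g : ev [seq (q.1 * q'.1, q.2 * q'.2) | q <- u, q' <- v] g =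
    ev u g * ev v g.
  rewrite /ev big_allpairs_dep mulr_suml; apply: eq_bigr => q _.
  by rewrite mulr_sumr; apply: eq_bigr => q' _; rewrite /= rmorphM mulrACA.
have /choice[w zw] g : exists w, g != 1%g -> (z - galg_act S g z) * w = 1.
  case: (eqVneq g 1%g) => [_|g1]; first by exists 0.
  by have [w zw] := z_sep g g1; exists w.
have [u uE] : exists u, forall g, ev u g =
    \prod_(k : G | k != 1%g) ((galg_act S g z - galg_act S k z) * w k).
  elim: (index_enum G) => [|k r [u uE]].
    exists [:: (1, 1)] => g.
    by rewrite big_nil /ev big_seq1 /= rmorph1 mulr1.
  have [k1|k1] := boolP (k != 1%g); last first.
    by exists u => g; rewrite big_cons (negPf k1).
  exists [seq (q.1 * q'.1, q.2 * q'.2) |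
          q <- [:: (w k, z); (- (w k * galg_act S k z), 1)], q' <- u] => g.
  rewrite evM uE big_cons k1; congr (_ * _).
  by rewrite /ev !big_cons big_nil /= rmorph1; ring.
exists u => g; rewrite uE; have [->|g1] := eqVneq g 1%g.
  by apply: big1 => k k1; rewrite galg_act1 zw.
by rewrite (bigD1 g) //= subrr !mul0r.
Qed.
(* The last two clauses characterise S as                                     *)
(* [A[X] / (qnum_prod r p X - a)], with z the class of X.                     *)
Definition affine_extension p (A : comPzRingType) (r a : A)
    (S : galg 'Z_p A) (z : S) : Prop :=
  [/\ is_galois S,
      forall g : 'Z_p, galg_act S g z =
        galg_str S r ^+ g * z + qnum (galg_str S r) g,
      forall (B : comPzRingType) (f : {rmorphism A -> B}) (b : B),
        qnum_prod (f r) p b = f a ->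
        exists psi : {rmorphism S -> B},
          (forall c, psi (galg_str S c) = f c) /\ psi z = b
    & forall (B : comPzRingType) (phi psi : {rmorphism S -> B}),
        (forall c, phi (galg_str S c) = psi (galg_str S c)) ->
        phi z = psi z -> phi =1 psi].

Lemma exists_affine_extension_nz p (A : comNzRingType) (r a : A) :
  prime p -> qnum r p = 0 -> invertible (1 + (r - 1) ^+ p * a) ->
  exists (S : galg 'Z_p A) (z : S), affine_extension r a z.
Proof.
move=> p_pr r_p a_unit.
have [p_gt0 p_gt1] := (prime_gt0 p_pr, prime_gt1 p_pr).
pose q : {poly A} := qnum_prod r%:P p 'X - a%:P.
have prodE : qnum_prod r%:P p 'X =
    \prod_(i <- index_iota 0 p) ('X - (qnum r i)%:P).
  by rewrite big_mkord; apply: eq_bigr => i _; rewrite rmorph_qnum.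
have size_a : (size (- a%:P) < size (qnum_prod r%:P p 'X))%N.
  rewrite prodE size_prod_XsubC size_iota subn0 size_polyN.
  by apply: leq_ltn_trans (size_polyC_leq1 a) _.
have q_monic : q \is monic.
  by rewrite monicE lead_coefDl // prodE -monicE monic_prod_XsubC.
have q_size : size q = p.+1.
  by rewrite size_polyDl // prodE size_prod_XsubC size_iota subn0.
have q_size1 : (1 < size q)%N by rewrite q_size.
have qE : mk_monic q = q by rewrite /mk_monic q_size1 q_monic.
pose S := {poly %/ q}; pose z : S := qpolyX q.
pose str : {rmorphism A -> S} := in_qpoly q \o polyC.
have lift (B : comPzRingType) (f : {rmorphism A -> B}) (b : B) :
    qnum_prod (f r) p b = f a ->
    exists psi : {rmorphism S -> B}, (forall c, psi (str c) = f c) /\ psi z = b.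
  move=> fb; have [phi [phiC phiX]] := exists_poly_lift f b.
  have [||psi psiE] := exists_qpoly_lift (phi := phi) q_monic => //.
    by rewrite rmorphB rmorph_qnum_prod !phiC phiX fb subrr.
  by exists psi; split=> [c|]; rewrite -?phiC -?phiX -psiE.
have z_root : qnum_prod (str r) p z = str a.
  have : in_qpoly q q = 0 by apply/val_inj; rewrite /= qE Pdiv.RingMonic.rmodpp.
  by rewrite {2}/q rmorphB rmorph_qnum_prod => /subr0_eq.
have strE c : (str c : {poly A}) = c%:P.
  apply: in_qpoly_small.
  by rewrite qE q_size (leq_ltn_trans (size_polyC_leq1 c)).
pose t := str r.
have t_p : qnum t p = 0 by rewrite -rmorph_qnum r_p rmorph0.
have /choice[act actP] (g : 'Z_p) : exists psi : {rmorphism S -> S},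
    (forall c, psi (str c) = str c) /\ psi z = t ^+ g * z + qnum t g.
  by apply: lift; rewrite qnum_prod_stable.
have act_str g c : act g (str c) = str c by have [] := actP g.
have act_z g : act g z = t ^+ g * z + qnum t g by have [] := actP g.
have act1 s : act 1%g s = s.
  apply: (qpoly_ext (psi := idfun)) => [c|]; first exact: act_str.
  by rewrite act_z /= mul1r qnum0 addr0.
have actM g h s : act (g * h)%g s = act g (act h s).
  apply: (qpoly_ext (psi := act g \o act h)) => [c|] /=.
    by rewrite [LHS]act_str [in RHS](act_str h) act_str.
  rewrite [LHS]act_z (act_z h) rmorphD rmorphM rmorphXn act_z rmorph_qnum.
  rewrite act_str.
  rewrite Zp_mulE // (qnum_mod t_p) (expr_mod _ (qnum0_expr t_p)) addnC exprD.
  by rewrite qnumD -/t; ring.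
pose E : galg 'Z_p A := @Galg 'Z_p A S str act act1 actM act_str.
have t_unit : invertible (1 + (t - 1) * z).
  apply: (invertible_qnum_prod t_p p_pr); rewrite z_root.
  have [w aw] := a_unit; exists (str w).
  by rewrite -(rmorph1 str) -(rmorphB str) -(rmorphXn str) -rmorphM -rmorphD
             -rmorphM aw.
have z_sep (g : 'Z_p) : g != 1%g -> invertible (z - act g z).
  move=> g1; have [w zw] := t_unit.
  have [||v gv] := @qnum_invertible _ t p t_p g.
  - rewrite coprime_sym prime_coprime // gtnNdvd //.
      by rewrite lt0n.
    by rewrite -[X in (_ < X)%N](Zp_cast p_gt1).
  - by rewrite lt0n.
  exists (- (w * v)); rewrite act_z.
  have -> : z - (t ^+ g * z + qnum t g) = - ((1 + (t - 1) * z) * qnum t g).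
    by rewrite mulrDl mul1r mulrAC -subrX1; ring.
  by rewrite mulrNN mulrACA zw gv mulr1.
have [n [x [y xy]]] := exists_dual_bases (S := E) z_sep.
exists E, z; split=> //; last by move=> B; apply: qpoly_ext.
split; last by exists n, x, y.
- move=> b c /(congr1 (fun x : S => (x : {poly A}))).
  by rewrite !strE => /polyC_inj.
(* P is the representative of s of degree below p, with coefficients moved to S. As s is fixed, P -
   s vanishes at the p conjugates of z, whose differences are units; so P = s and s is its constant
   coefficient. *)
move=> s s_fix; pose P := map_poly str (s : {poly A}).
have P_horner (g : 'Z_p) : P.[act g z] = s.
  rewrite -[RHS](s_fix g) -[in RHS](in_qpolyK s) /P.
  elim/poly_ind: (s : {poly A}) => [|Q c IHQ].
    by rewrite !rmorph0 horner0.
  rewrite !rmorphD !rmorphM /= map_polyX map_polyC hornerMXaddC IHQ.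
  by congr (_ + _); apply/esym/act_str.
have P_s : P = s%:P.
  apply/subr0_eq.
  apply: (@separated_roots_eq0 S _ (fun g : 'Z_p => act g z) (enum 'Z_p)).
  - exact: enum_uniq.
  - move=> g h gh.
    have [|w zw] := z_sep (h^-1 * g)%g; first by rewrite -eq_mulVg1 eq_sym.
    exists (act h (- w)).
    have -> : act g z - act h z = act h (- (z - act (h^-1 * g)%g z)).
      by rewrite opprB rmorphB -actM mulKVg.
    by rewrite -rmorphM mulrNN zw rmorph1.
  - by move=> g; rewrite rootE hornerD hornerN hornerC P_horner subrr.
  rewrite -cardE card_ord Zp_cast // (leq_trans (size_polyD _ _)) //.
  rewrite size_polyN geq_max (leq_trans (size_polyC_leq1 _)) // andbT.
  rewrite (leq_trans (size_poly _ _)) //.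
  by rewrite -ltnS -q_size -{2}qE size_mk_monic.
exists ((s : {poly A})`_0).
by rewrite -[RHS](coefC s 0) -P_s coef_map.
Qed.
Lemma exists_affine_extension p (A : comPzRingType) (r a : A) :
  prime p -> qnum r p = 0 -> invertible (1 + (r - 1) ^+ p * a) ->
  exists (S : galg 'Z_p A) (z : S), affine_extension r a z.
Proof.
have [A0|/exists_nzring[A1 eqA]] := eqVneq (1 : A) 0; last first.
  by case: A / eqA in r a *; apply: exists_affine_extension_nz.
move=> _ _ _.
have eqA (x y : A) : x = y by apply: zero_ring_eq.
(* Over the zero ring A itself serves: every ring receiving a morphism from A is zero. *)
exists (@Galg 'Z_p A A idfun (fun=> idfun) (fun=> erefl) (fun _ _ _ => erefl)
  (fun _ _ => erefl)), 0.
split=> //=.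
- split=> [x y _|s _|]; [exact: eqA | by exists s |].
  by exists 0, (fun=> 0), (fun=> 0) => g; apply: eqA.
- move=> B f b _; exists f; split=> //; apply: zero_ring_eq.
  by rewrite -(rmorph1 f) A0 rmorph0.
Qed.

(** * Lifting the extension *)

Lemma qnum_rho p : (1 < p)%N -> qnum (rho p) p = 0.
Proof.
move=> p_gt1.
rewrite /rho /qpolyX -rmorph_qnum -[qnum _ _]/(cyclo_sum p).
apply/val_inj; rewrite /= mk_monic_cyclo_sum //.
by rewrite Pdiv.RingMonic.rmodpp // -mk_monic_cyclo_sum // monic_mk_monic.
Qed.

Theorem corollary1p6 (p : nat) (p_prime : prime p)
    (R' R'' : comPzRingType)
    (i' : {rmorphism Zrho p -> R'}) (i'' : {rmorphism Zrho p -> R''})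
    (h : {rmorphism R' -> R''})
    (h_alg : forall z : Zrho p, h (i' z) = i'' z)
    (h_surj : forall y : R'', exists x : R', h x = y)
    (h_unit : forall x : R',
       (exists r : R'', h x = 1 + i'' (eta p) ^+ p * r) -> invertible x)
    (S'' : galg 'Z_p R'') (S''_galois : is_galois S'') :
  exists S' : galg 'Z_p R',
    is_galois S' /\ galg_iso (base_change h S') S''.
Proof.
have p_gt1 := prime_gt1 p_prime; have p_gt0 := prime_gt0 p_prime.
pose r' := i' (rho p); pose r'' := i'' (rho p).
have r'_p : qnum r' p = 0 by rewrite -rmorph_qnum qnum_rho // rmorph0.
have r''_p : qnum r'' p = 0 by rewrite -rmorph_qnum qnum_rho // rmorph0.
have hr : h r' = r'' by apply: h_alg.
have [theta theta_act] := exists_affine p_gt1 r''_p S''_galois.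
have str_p : qnum (galg_str S'' r'') p = 0.
  by rewrite -rmorph_qnum r''_p rmorph0.
have [_ S''_fix _] := S''_galois.
have [a'' a''E] : exists a'',
    galg_str S'' a'' = qnum_prod (galg_str S'' r'') p theta.
  apply: S''_fix => g.
  by rewrite rmorph_qnum_prod galg_act_str theta_act qnum_prod_stable.
have [a' a'E] := h_surj a''.
have a'_unit : invertible (1 + (r' - 1) ^+ p * a').
  apply: h_unit; exists a''.
  by rewrite rmorphD rmorphM rmorphXn rmorphB !rmorph1 hr a'E rmorphB rmorph1.
have [S' [z [S'_gal z_act S'_lift S'_ext]]] :=
  exists_affine_extension p_prime r'_p a'_unit.
exists S'; split=> //.
(* z |-> theta is allowed since F(theta) = a'' = h(a'). *)
have [|psi [psi_str psi_z]] := S'_lift S'' (galg_str S'' \o h) theta.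
  by rewrite /= hr a'E a''E.
have psi_act g s : psi (galg_act S' g s) = galg_act S'' g (psi s).
  (* Equivariance need only be checked on R' and z, where both generators obey the same affine
     formula. *)
  apply: (S'_ext _ (psi \o galg_act S' g) (galg_act S'' g \o psi)) => [c|] /=.
    by rewrite galg_act_str psi_str galg_act_str.
  rewrite z_act rmorphD rmorphM rmorphXn rmorph_qnum psi_str psi_z theta_act.
  by rewrite /= hr.
have [phi [phi_inl phi_inr]] := exists_tens_lift (g := h) psi_str.
have phi_act g t :
    phi (galg_act (base_change h S') g t) = galg_act S'' g (phi t).
  rewrite -(treprK t) tpi_sum !rmorph_sum; apply: eq_bigr => q _.
  rewrite !rmorphM base_change_act_inl (galg_act_str (base_change h S')).
  by rewrite phi_inl phi_inr galg_act_str psi_act phi_inl.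
exists phi; split=> //.
have [_ S'_fix [n [x [y xy]]]] := S'_gal.
apply: (equivariant_bijective (dual_bases_base_change h xy)) => //.
by apply: trace_base_change => s; apply: S'_fix => g; apply: act_trace.
Qed.
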